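(* Let $\mathfrak{v}$ be a finite dimensional Euclidean space and let $G\subseteq\mathrm{O}(\mathfrak{v})$ be a finite group. Then property (SP) is equivalent to each of the following properties: (i) for any $v\in\mathfrak{v}^{\mathrm{reg}}$, the functional $\lambda_v$ has a peak on each $G$-orbit in $\mathfrak{v}$; (ii) $G$ is a Coxeter group; (iii) if $v\in\mathfrak{v}^{\mathrm{reg}}$, then $C_u=C_v$ for any $u$ from some neighborhood of $v$.
   Context: $O_v=Gv$ is the $G$-orbit of $v$; $\widehat{X}$ is the convex hull of $X\subseteq\mathfrak{v}$; $A+B=\{a+b:a\in A,\ b\in B\}$. Property (SP): the family $\{\widehat{O}_v\}_{v\in\mathfrak{v}}$ is a semigroup with respect to Minkowski addition, i.e. for all $u,v\in\mathfrak{v}$ there is $w\in\mathfrak{v}$ with $\widehat{O}_u+\widehat{O}_v=\widehat{O}_w$. $G_v$ is the stabilizer of $v$ in $G$. A point $v\in\mathfrak{v}$ is regular if $G_v$ is minimal: for $u\in\mathfrak{v}$, $G_u\subseteq G_v$ implies $G_u=G_v$. $\mathfrak{v}^{\mathrm{reg}}$ is the set of regular points (for finite $G$: the points with trivial stabilizer). $\lambda_v(u)=\langle v,u\rangle$. A real function $f$ has a peak on a set $X$ if the set of points of $X$ at which $f$ attains its maximum over $X$ consists of exactly one point. $C_v=\{u\in\mathfrak{v}:\ \langle u,v-gv\rangle\ge 0\ \text{for all } g\in G\}$. A Coxeter group here means a finite linear group (acting orthogonally) generated by reflections in hyperplanes (the trivial group is included). *)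

(* Defs.v *)
From mathcomp Require Import all_boot all_order all_algebra.
From mathcomp Require Import boolp classical_sets functions cardinality reals convex.

Set Implicit Arguments.
Unset Strict Implicit.
Unset Printing Implicit Defensive.

Import Order.TTheory GRing.Theory Num.Theory.
Local Open Scope classical_set_scope.
Local Open Scope ring_scope.

Section Peak.
Context {R : realType} {T : Type}.

Definition argmax_set (f : T -> R) (X : set T) : set T :=
  [set x | X x /\ forall y, X y -> f y <= f x].

Definition has_peak (f : T -> R) (X : set T) : Prop :=
  exists x, argmax_set f X = [set x].

End Peak.

Section LinearGroups.
Context {R : realType} {V : vectType R}.
Implicit Types (G S : set 'End(V)) (u v w : V).

(* The composition \o is used rather than the ring product on 'End(V),
   which exists only when V is nonzero. *)
Definition linear_group G : Prop :=
  [/\ G \1%VF,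
      forall g h, G g -> G h -> G (g \o h)%VF &
      forall g, G g ->
        exists2 h, G h & (g \o h)%VF = \1%VF /\ (h \o g)%VF = \1%VF].

Definition generated_group S : set 'End(V) := smallest linear_group S.

Definition orbit_of G v : set V := [set g v | g in G].

Definition stabilizer G v : set 'End(V) := [set g | G g /\ g v = v].

Definition regular_point G v : Prop :=
  forall u, stabilizer G u `<=` stabilizer G v ->
    stabilizer G u = stabilizer G v.

Definition convex_hull (X : set V) : set V := smallest (@convex_set R V) X.

Definition minkowski_sum (A B : set V) : set V :=
  [set a + b | a in A & b in B].

Definition property_SP G : Prop :=
  forall u v, exists w,
    minkowski_sum (convex_hull (orbit_of G u)) (convex_hull (orbit_of G v)) =
    convex_hull (orbit_of G w).

End LinearGroups.

(* A Euclidean space is a finite-dimensional real vector space V together with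
   a positive definite symmetric bilinear form dotp; the form is a separate
   argument because vectType carries no inner product. *)
Section Euclidean.
Context {R : realType} {V : vectType R} (dotp : {dot V for idfun}).
Implicit Types (G S : set 'End(V)) (u v a : V).

Definition finite_orthogonal_group G : Prop :=
  [/\ linear_group G, finite_set G & forall g, G g -> isometry dotp dotp g].

Definition is_reflection (s : 'End(V)) : Prop :=
  exists2 a, a != 0 &
    forall u, s u = u - (2 * dotp u a / dotp a a) *: a.

Definition coxeter_group G : Prop :=
  finite_orthogonal_group G /\
  exists2 S, S `<=` is_reflection & G = generated_group S.

Definition chamber G v : set V :=
  [set u | forall g, G g -> 0 <= dotp u (v - g v)].

(* vectType carries no topology: neighborhoods are those of the norm
   sqrt (dotp x x). *)
Definition near_point v (P : V -> Prop) : Prop :=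
  exists2 e : R, 0 < e &
    forall u, Num.sqrt (dotp (u - v) (u - v)) < e -> P u.

Definition peak_property G : Prop :=
  forall v, regular_point G v -> forall u, has_peak (dotp v) (orbit_of G u).

Definition chamber_locally_constant G : Prop :=
  forall v, regular_point G v ->
    near_point v (fun u => chamber G u = chamber G v).

End Euclidean.

(* Main.v *)
(* SP implies (i): if x and k x both maximize <v, .> on O_u, then v + x and
   v + k x are vertices of the sum of the hulls of O_v and O_u, hence lie in one
   orbit O_w; an element g carrying the first to the second must fix v, so g = 1
   and k x = x.

   (i) implies (ii): take v with trivial stabilizer and, in a coset of the
   reflection subgroup, k maximizing <v, k v>. If k <> 1, follow the segment from
   v to a generic point near k v, which crosses no mirror; at the first point x
   where some h v overtakes v, the peak property gives h x = x. Genericity forces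
   h to be a reflection, whose mirror would contain x, a contradiction.

   (iii) implies (i): if x and g x both maximize <v, .> then they do so for
   v + e (x - g x) as well, which forces x = g x.

   (ii) implies SP and (iii): the exchange argument shows that the closed region
   bounded by the mirrors and containing v meets each orbit exactly once, so it
   equals C_v. It depends only on the signs of v on the roots, whence (iii).
   For SP, with u and z in that region, x + z is in the hull of O_(u+z) for all x
   in O_u, by induction on decreasing <v, x>. *)
Require Import Defs.
From HB Require Import structures.
From mathcomp Require Import all_boot all_order all_algebra ring lra.
From mathcomp Require Import boolp classical_sets functions cardinality reals convex.
From mathcomp Require Import interval_inference.

Local Open Scope classical_set_scope.
Local Open Scope ring_scope.

Set Implicit Arguments.
Unset Strict Implicit.
Unset Printing Implicit Defensive.

Import Order.TTheory GRing.Theory Num.Theory.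

(** * Extremal elements of finite sets *)

Section FiniteSets.
Context {R : realType} {T : eqType}.
Implicit Types (A : set T) (f : T -> R).

Lemma finite_argmax A f : finite_set A -> A !=set0 ->
  exists2 x, A x & forall y, A y -> f y <= f x.
Proof.
move=> /finite_seqP[s ->]; elim: s => [|a s IHs]; first by case.
move=> _; case: (pselect ([set` s] !=set0)) => [/IHs[x xs xmax]|s0].
  case: (leP (f a) (f x)) => fax.
    exists x => [|y]; first by rewrite /= inE xs orbT.
    by rewrite /= inE => /orP[/eqP->//|]; apply: xmax.
  exists a => [|y]; first by rewrite /= inE eqxx.
  rewrite /= inE => /orP[/eqP->//|ys].
  by rewrite (le_trans (xmax _ ys)) // ltW.
exists a => [|y]; first by rewrite /= inE eqxx.
by rewrite /= inE => /orP[/eqP->//|ys]; case: s0; exists y.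
Qed.

(** A nonempty finite set of counterexamples would have one with least [f], to which the induction
    step applies. *)
Lemma finite_lt_ind A f (P : T -> Prop) : finite_set A ->
  (forall x, A x -> (forall y, A y -> f y < f x -> P y) -> P x) ->
  forall x, A x -> P x.
Proof.
move=> finA step x Ax; apply: contrapT => nPx.
have [||y [Ay nPy] ymin] := @finite_argmax (A `&` ~` P) (fun z => - f z).
- exact: sub_finite_set finA.
- by exists x.
apply: nPy; apply: step => // z Az fzy; apply: contrapT => nPz.
by have := ymin z (conj Az nPz); rewrite lerN2 leNgt fzy.
Qed.

Lemma finite_inf_gt0 A f : finite_set A -> (forall x, A x -> 0 < f x) ->
  exists2 e : R, 0 < e & forall x, A x -> e <= f x.
Proof.
move=> finA fpos; case: (pselect (A !=set0)) => [A0|A0].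
  have [x Ax xmin] := @finite_argmax A (fun z => - f z) finA A0.
  by exists (f x) => [|y /xmin]; [exact: fpos | rewrite lerN2].
by exists 1 => // x Ax; case: A0; exists x.
Qed.

End FiniteSets.

(** * Inner product estimates and generic points *)

Section DotProduct.
Context {R : realType} {V : vectType R} (dotp : {dot V for idfun}).
Implicit Types (u v w a b : V) (k : R).
Local Notation "''[' u , v ]" := (dotp u v) : ring_scope.

Lemma dotC u v : '[u, v] = '[v, u].
Proof. by rewrite (hermC dotp) expr0 mul1r. Qed.
Lemma dotDl u v w : '[u + v, w] = '[u, w] + '[v, w].
Proof. exact: linearDl. Qed.
Lemma dotDr u v w : '[w, u + v] = '[w, u] + '[w, v].
Proof. exact: linearDr. Qed.
Lemma dotNl u w : '[- u, w] = - '[u, w].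
Proof. exact: linearNl. Qed.
Lemma dotNr u w : '[w, - u] = - '[w, u].
Proof. exact: linearNr. Qed.
Lemma dotZl k u w : '[k *: u, w] = k * '[u, w].
Proof. exact: linearZl_LR. Qed.
Lemma dotZr k u w : '[w, k *: u] = k * '[w, u].
Proof. exact: linearZr_LR. Qed.
Lemma dot0l w : '[0, w] = 0.
Proof. exact: linear0l. Qed.

Definition dotE := (dotDl, dotDr, dotNl, dotNr, dotZl, dotZr).

Lemma dot_gt0 u : u != 0 -> 0 < '[u, u].
Proof. exact: neq0_dnorm_gt0. Qed.

Lemma dot_ge0 u : 0 <= '[u, u].
Proof.
by have [->|/dot_gt0/ltW//] := eqVneq u 0; rewrite dot0l.
Qed.

Lemma dot_sqr_lt u v : (forall k, u != k *: v) -> v != 0 ->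
  '[u, v] ^+ 2 < '[u, u] * '[v, v].
Proof.
(* [w] is the component of [u] orthogonal to [v]. *)
move=> nuv /dot_gt0 v0; pose w := u - ('[u, v] / '[v, v]) *: v.
have : 0 < '[w, w] * '[v, v] by rewrite mulr_gt0 // dot_gt0 // subr_eq0.
have -> : '[w, w] * '[v, v] = '[u, u] * '[v, v] - '[u, v] ^+ 2.
  by rewrite /w !dotE (dotC v u); field; rewrite gt_eqF.
by rewrite subr_gt0.
Qed.

Lemma dot_sqr_le u v : '[u, v] ^+ 2 <= '[u, u] * '[v, v].
Proof.
have [->|v0] := eqVneq v 0; first by rewrite dotC !dot0l expr0n mulr0.
case: (pselect (exists k, u = k *: v)) => [[k ->]|nk].
  by rewrite !dotE le_eqVlt; apply/orP; left; apply/eqP; ring.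
apply/ltW/dot_sqr_lt => // k; apply/eqP => uk.
by apply: nk; exists k.
Qed.

Lemma finite_small_step (F : set V) u v : finite_set F ->
  (forall f, F f -> 0 < '[f, u]) ->
  exists2 e : R, 0 < e & forall f, F f -> 0 < '[f, u + e *: v].
Proof.
move=> finF Fpos.
(* The [1 +] keeps the denominator positive and makes e |<f, v>| strictly smaller than <f, u>. *)
have [|e e0 le_e] := @finite_inf_gt0 _ _ F
    (fun f => '[f, u] / (1 + `|'[f, v]|)) finF.
  by move=> f /Fpos fu; rewrite divr_gt0 // ltr_wpDr.
exists e => // f Ff; rewrite !dotE.
have := le_e f Ff; rewrite ler_pdivlMr; last by rewrite ltr_wpDr.
have : e * (- `|'[f, v]|) <= e * '[f, v] by rewrite ler_pM2l // lerNl ler_normr lexx orbT.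
move=> h1 h2; lra.
Qed.

(** Induction on [ns]: a side of the hyperplane of [n] is chosen, and [n] or [- n] joins the strict
    constraints [fs], so that avoiding the other hyperplanes cannot undo the choice. If [u] lies on
    the hyperplane, a small step along [n] leaves it first. *)
Lemma generic_point (ns fs : seq V) u : (forall n, n \in ns -> n != 0) ->
  (forall f, f \in fs -> 0 < '[f, u]) ->
  exists2 y, forall n, n \in ns -> '[n, y] != 0
           & forall f, f \in fs -> 0 < '[f, y].
Proof.
elim: ns fs u => [|n ns IHns] fs u ns0 fpos; first by exists u.
suff [n' [y y1 y2]] : exists n', exists2 y, (forall m, m \in ns -> '[m, y] != 0) &
    (n' = n \/ n' = - n) /\ forall f, f \in n' :: fs -> 0 < '[f, y].
  exists y => [m|f ffs]; last by apply: y2.2; rewrite inE ffs orbT.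
  rewrite inE => /orP[/eqP->|/y1//].
  have := y2.2 n'; rewrite inE eqxx => /(_ isT).
  by case: y2.1 => ->; rewrite ?dotNl ?oppr_gt0; [move/gt_eqF|move/lt_eqF] => ->.
have IH n' u' (Hn' : n' = n \/ n' = - n) : (forall f, f \in n' :: fs -> 0 < '[f, u']) ->
    exists n', exists2 y, (forall m, m \in ns -> '[m, y] != 0) &
    (n' = n \/ n' = - n) /\ forall f, f \in n' :: fs -> 0 < '[f, y].
  move=> pos; have [|y y1 y2] := IHns (n' :: fs) u' _ pos.
    by move=> m mns; apply: ns0; rewrite inE mns orbT.
  by exists n'; exists y.
case: (ltgtP '[n, u] 0) => nu.
- apply: (IH (- n) u); first by right.
  by move=> f; rewrite inE => /orP[/eqP->|/fpos//]; rewrite dotNl oppr_gt0.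
- apply: (IH n u); first by left.
  by move=> f; rewrite inE => /orP[/eqP->//|/fpos//].
have n0 : n != 0 by apply: ns0; rewrite inE eqxx.
have [||e e0 epos] := @finite_small_step [set` fs] u n.
- exact: finite_seq.
- exact: fpos.
apply: (IH n (u + e *: n)); first by left.
move=> f; rewrite inE => /orP[/eqP->|/epos//].
by rewrite !dotE nu add0r mulr_gt0 ?dot_gt0.
Qed.

(** * Reflections *)

Fact reflection_fun_is_linear a :
  linear (fun u => u - (2 * '[u, a] / '[a, a]) *: a).
Proof.
move=> k u v; rewrite !dotE scalerBr scalerA addrACA; congr (_ + _).
by rewrite -opprD -scalerDl; congr (- (_ *: _)); ring.
Qed.

Definition reflection_fun a u := u - (2 * '[u, a] / '[a, a]) *: a.
HB.instance Definition _ a :=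
  GRing.isLinear.Build R V V *:%R (reflection_fun a) (@reflection_fun_is_linear a).

Definition refl a : 'End(V) := linfun (reflection_fun a).

Lemma reflE a u : refl a u = u - (2 * '[u, a] / '[a, a]) *: a.
Proof. exact: lfunE. Qed.

Lemma is_reflectionP s : is_reflection dotp s <-> exists2 a, a != 0 & s = refl a.
Proof.
split=> [[a a0 sE]|[a a0 ->]]; exists a => //; last exact: reflE.
by apply/lfunP => u; rewrite sE reflE.
Qed.

Lemma refl_id a u : '[u, a] = 0 -> refl a u = u.
Proof. by move=> ua; rewrite reflE ua mulr0 mul0r scale0r subr0. Qed.

Lemma refl_root a : a != 0 -> refl a a = - a.
Proof.
move=> /dot_gt0/gt_eqF a0; rewrite reflE mulfK ?a0 //.
by rewrite scaler_nat mulr2n opprD addrA subrr add0r.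
Qed.

Lemma dot_refl a u v : a != 0 -> '[refl a u, v] = '[u, refl a v].
Proof.
move=> a0; rewrite !reflE !dotE (dotC a v); ring.
Qed.

Lemma reflK a u : a != 0 -> refl a (refl a u) = u.
Proof.
move=> a0; rewrite [in LHS](reflE a u) linearB linearZ /= refl_root // reflE.
by rewrite scalerN opprK subrK.
Qed.

Lemma dot_refl_root a u : a != 0 -> '[refl a u, a] = - '[u, a].
Proof. by move=> a0; rewrite dot_refl // refl_root // dotNr. Qed.

Lemma reflZ k a : k != 0 -> refl (k *: a) = refl a.
Proof.
move=> k0; apply/lfunP => u; rewrite !reflE !dotE scalerA.
have [->|/dot_gt0/gt_eqF a0] := eqVneq a 0; first by rewrite !scaler0.
by congr (_ - _ *: _); field; rewrite a0.
Qed.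

Lemma reflN a : refl (- a) = refl a.
Proof. by rewrite -scaleN1r reflZ // oppr_eq0 oner_eq0. Qed.

Lemma refl_neq1 a : a != 0 -> refl a <> \1%VF.
Proof.
move=> a0 /lfunP/(_ a); rewrite refl_root // id_lfunE => aN.
move: (dot_gt0 a0); rewrite -{1}aN dotNl oppr_gt0 => /ltW.
by rewrite leNgt dot_gt0.
Qed.

Lemma refl_conj (g h : 'End(V)) b : isometry dotp dotp g ->
  cancel h g -> refl (g b) = (g \o (refl b \o h))%VF.
Proof.
move=> iso_g hK; apply/lfunP => u; rewrite !comp_lfunE !reflE linearB /=.
have -> k x : g (k *: x) = k *: g x by exact: linearZ.
by rewrite hK -{2}(hK u) !iso_g.
Qed.

End DotProduct.

(** * Convex hulls and Minkowski sums *)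

Section ConvexHull.
Context {R : realType} {V : vectType R} (dotp : {dot V for idfun}).
Implicit Types (A B X Y : set V) (u v : V).
Local Notation "''[' u , v ]" := (dotp u v) : ring_scope.

Lemma convex_setP A : @convex_set R V A <->
  forall x y (t : R), 0 <= t -> t <= 1 -> A x -> A y -> A (t *: x + (1 - t) *: y).
Proof.
split=> [cA x y t t0 t1 Ax Ay|cA x y t].
  by have := cA x y (Itv01 t0 t1); rewrite !in_setE; apply.
by rewrite !in_setE; apply: cA.
Qed.

Lemma sub_convex_hull X : X `<=` convex_hull X.
Proof. exact: sub_gen_smallest. Qed.

Lemma convex_hull_convex X : @convex_set R V (convex_hull X).
Proof.
apply/convex_setP => x y t t0 t1 Xx Xy A [/= cA XA].
by apply: (convex_setP A).1 => //; [apply: Xx | apply: Xy].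
Qed.

Lemma minkowski_sum_convex A B : @convex_set R V A -> @convex_set R V B ->
  @convex_set R V (minkowski_sum A B).
Proof.
move=> /convex_setP cA /convex_setP cB; apply/convex_setP => x y t t0 t1.
move=> [a Aa [b Bb <-]] [a' Aa' [b' Bb' <-]].
exists (t *: a + (1 - t) *: a'); first exact: cA.
exists (t *: b + (1 - t) *: b'); first exact: cB.
by rewrite addrACA -!scalerDr.
Qed.

(** Translates of [A] are convex, so one summand can be extended to its hull while the other is held
    fixed. *)
Lemma minkowski_sum_hull_sub X Y A : @convex_set R V A ->
  (forall x y, X x -> Y y -> A (x + y)) ->
  minkowski_sum (convex_hull X) (convex_hull Y) `<=` A.
Proof.
move=> /convex_setP cA XYA _ [a Xa [b Yb <-]].
have trans c : @convex_set R V [set x | A (x + c)].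
  apply/convex_setP => x y t t0 t1 Ax Ay /=.
  have -> : t *: x + (1 - t) *: y + c = t *: (x + c) + (1 - t) *: (y + c).
    by rewrite !scalerDr addrACA -scalerDl addrC [t + _]addrC subrK scale1r addrC.
  exact: cA.
suff: convex_hull X `<=` [set x | A (x + b)] by apply.
apply: smallest_sub => // x Xx /=; rewrite addrC.
suff: convex_hull Y `<=` [set y | A (y + x)] by apply.
by apply: smallest_sub => // y Yy /=; rewrite addrC; apply: XYA.
Qed.

Lemma half_space_convex v (M : R) : @convex_set R V [set x | '[x, v] < M].
Proof.
apply/convex_setP => x y t t0 t1 /= xM yM; rewrite !dotE.
have [->|tn0] := eqVneq t 0; first by rewrite mul0r add0r subr0 mul1r.
have t_gt0 : 0 < t by rewrite lt_neqAle eq_sym tn0.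
have := ltr_pM2l t_gt0 '[x, v] M; rewrite xM => xtM.
have : (1 - t) * '[y, v] <= (1 - t) * M by rewrite ler_wpM2l ?subr_ge0 // ltW.
lra.
Qed.

(** The implication [x <> p -> '[x, v] < '[p, v]] itself defines a convex set, so it passes from [X]
    to the hull. *)
Lemma convex_hull_peak X p v :
  (forall x, X x -> x <> p -> '[x, v] < '[p, v]) ->
  forall x, convex_hull X x -> x <> p -> '[x, v] < '[p, v].
Proof.
move=> Xp x; have peak_convex : @convex_set R V [set x | x <> p -> '[x, v] < '[p, v]].
  apply/convex_setP => {}x y t t0 t1 /= xp yp xyp; rewrite !dotE.
  case: (pselect (x = p)) => [xE|/xp {}xp]; first subst x.
    case: (pselect (y = p)) => [yE|/yp {}yp].
      by subst y; case: xyp; rewrite -scalerDl addrC subrK scale1r.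
    have [tE|tn1] := eqVneq t 1.
      by case: xyp; rewrite tE subrr scale1r scale0r addr0.
    have t_lt1 : 0 < 1 - t by rewrite subr_gt0 lt_neqAle tn1.
    by have := ltr_pM2l t_lt1 '[y, v] '[p, v]; rewrite yp => ?; lra.
  have [tE|tn0] := eqVneq t 0.
    move: xyp; rewrite tE mul0r scale0r !add0r subr0 scale1r mul1r; exact: yp.
  have t_gt0 : 0 < t by rewrite lt_neqAle eq_sym tn0.
  have : (1 - t) * '[y, v] <= (1 - t) * '[p, v].
    rewrite ler_wpM2l ?subr_ge0 //.
    by case: (pselect (y = p)) => [->//|/yp/ltW].
  by have := ltr_pM2l t_gt0 '[x, v] '[p, v]; rewrite xp => ? ?; lra.
suff: convex_hull X `<=` [set x | x <> p -> '[x, v] < '[p, v]] by apply.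
exact: smallest_sub.
Qed.

End ConvexHull.

(** * Finite orthogonal groups: orbits and points with trivial stabilizer *)

Section FiniteOrthogonalGroup.
Context {R : realType} {V : vectType R} (dotp : {dot V for idfun}).
Variable G : set 'End(V).
Hypothesis finG : finite_orthogonal_group dotp G.
Implicit Types (g h k : 'End(V)) (u v w x y a b : V).
Local Notation "''[' u , v ]" := (dotp u v) : ring_scope.

Let G_finite : finite_set G. Proof. by case: finG. Qed.
Let G1 : G \1%VF. Proof. by case: finG => -[]. Qed.
Let GM g h : G g -> G h -> G (g \o h)%VF. Proof. by case: finG => -[_ M _ _ _]; apply: M. Qed.

Lemma group_inv g : G g ->
  exists h, [/\ G h, cancel g h, cancel h g & forall u w, '[g u, w] = '[u, h w]].
Proof.
case: finG => -[_ _ inv] _ iso Gg; have [h Gh [gh hg]] := inv g Gg.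
have hK : cancel h g by move=> x; rewrite -comp_lfunE gh id_lfunE.
exists h; split=> // [x|u w]; first by rewrite -comp_lfunE hg id_lfunE.
by rewrite -{1}(hK w) (iso g Gg).
Qed.

Lemma group_isometry g u v : G g -> '[g u, g v] = '[u, v].
Proof. by case: finG => _ _ iso Gg; apply: iso. Qed.

Lemma dot_moved_lt g v : G g -> g v <> v -> '[v, g v] < '[v, v].
Proof.
move=> Gg gv; have /(dot_gt0 dotp) : v - g v != 0.
  by rewrite subr_eq0; apply/eqP => /esym.
rewrite !dotE (group_isometry _ _ Gg) (dotC _ (g v) v); lra.
Qed.

Lemma orbit_self v : orbit_of G v v.
Proof. by exists \1%VF => //; rewrite id_lfunE. Qed.

Lemma orbit_stable v x g : G g -> orbit_of G v x -> orbit_of G v (g x).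
Proof. by move=> Gg [h Gh <-]; exists (g \o h)%VF; [exact: GM | rewrite comp_lfunE]. Qed.

Lemma orbit_eq v x : orbit_of G v x -> orbit_of G v = orbit_of G x.
Proof.
move=> [g Gg gx]; have [h [Gh gK _ _]] := group_inv Gg.
apply/seteqP; split=> _ [k Gk <-]; last by apply: orbit_stable => //; exists g.
by apply: orbit_stable => //; exists h => //; rewrite -gx gK.
Qed.

Lemma orbit_argmax v u : exists2 x, orbit_of G u x &
  forall y, orbit_of G u y -> '[v, y] <= '[v, x].
Proof.
apply: (@finite_argmax _ _ (orbit_of G u) (dotp v)); first exact: finite_image.
by exists u; apply: orbit_self.
Qed.

Definition free_point v := forall g, G g -> g v = v -> g = \1%VF.

Lemma fixed_normal k : G k -> k <> \1%VF ->
  exists2 n, n != 0 & forall x, k x = x -> '[n, x] = 0.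
Proof.
move=> Gk kn1; have [z /eqP kz] : exists z, k z != z.
  apply: contrapT => nz; apply: kn1; apply/lfunP => x; rewrite id_lfunE.
  by apply: contrapT => /eqP kx; apply: nz; exists x.
have [h [_ kK _ hadj]] := group_inv Gk.
(* The inverse of [k] fixes what [k] fixes, so <k z, x> = <z, x> whenever k x = x. *)
exists (k z - z) => [|x kx]; first by rewrite subr_eq0; apply/eqP.
by rewrite !dotE hadj -{1}kx kK subrr.
Qed.

(** The fixed points of each nontrivial element lie in a hyperplane; a generic point avoids these
    finitely many hyperplanes. *)
Lemma free_point_exists : exists v, free_point v.
Proof.
have /choice[n nP] k : exists n, G k /\ k <> \1%VF ->
    n != 0 /\ forall x, k x = x -> '[n, x] = 0.
  case: (pselect (G k /\ k <> \1%VF)) => [[Gk kn1]|nk]; last by exists 0 => /nk.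
  by have [n n0 nx] := fixed_normal Gk kn1; exists n.
have /finite_seqP[s Gs] := G_finite.
have [||v nv _] := @generic_point _ _ dotp [seq n k | k <- s & k != \1%VF] [::] 0.
- move=> m /mapP[k]; rewrite mem_filter => /andP[/eqP k1 ks] ->.
  by apply: (nP k _).1; split=> //; rewrite Gs.
- by [].
exists v => k Gk kv; apply: contrapT => k1.
have ks : k \in [seq k <- s | k != \1%VF].
  by rewrite mem_filter; apply/andP; split; [apply/eqP | move: Gk; rewrite Gs].
by have := nv _ (map_f n ks); rewrite (nP k _).2 ?eqxx.
Qed.

Lemma free_point_regular v : free_point v -> regular_point G v.
Proof.
move=> fv u uv; apply/seteqP; split=> // g [Gg gv].
by rewrite (fv g Gg gv); split=> //; rewrite id_lfunE.
Qed.

(** The trivial stabilizer of some free point is contained in that of [v], so minimality makes the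
    two equal. *)
Lemma regular_free_point v : regular_point G v -> free_point v.
Proof.
move=> rv; have [v0 fv0] := free_point_exists.
move=> g Gg gv; suff [_] : stabilizer G v0 g by apply: fv0.
rewrite (rv v0) // => h [Gh /(fv0 h Gh) ->].
by split=> //; rewrite id_lfunE.
Qed.

(** Finiteness provides a maximizer and orbit points differ by an element of [G], so only uniqueness
    is at stake. *)
Lemma peak_on_orbit v u : has_peak (dotp v) (orbit_of G u) <->
  forall x g, G g -> argmax_set (dotp v) (orbit_of G u) x ->
    argmax_set (dotp v) (orbit_of G u) (g x) -> g x = x.
Proof.
split=> [[z zE] x g Gg|H]; first by rewrite zE /= => -> ->.
have [x ux xmax] := orbit_argmax v u.
exists x; apply/seteqP; split=> [y|_ ->] //= yP.
have [g Gg gxy] : orbit_of G x y by rewrite -(orbit_eq ux); case: yP.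
by subst y; apply: (H x g).
Qed.

End FiniteOrthogonalGroup.

(** * The peak property: derived from SP and from (iii), and implying (ii) *)

Section PeakProperty.
Context {R : realType} {V : vectType R} (dotp : {dot V for idfun}).
Variable G : set 'End(V).
Hypothesis finG : finite_orthogonal_group dotp G.
Implicit Types (g h k : 'End(V)) (u v w x y a b : V).
Local Notation "''[' u , v ]" := (dotp u v) : ring_scope.

Let G_finite : finite_set G. Proof. by case: finG. Qed.
Let G1 : G \1%VF. Proof. by case: finG => -[]. Qed.
Let GM g h : G g -> G h -> G (g \o h)%VF. Proof. by case: finG => -[_ M _ _ _]; apply: M. Qed.

(* The perturbation y = v + e x of v peaks on O_v at v and on O_u at x, hence on
   the sum of the hulls at v + x only. *)
Lemma argmax_sum_vertex v u w x :
  minkowski_sum (convex_hull (orbit_of G v)) (convex_hull (orbit_of G u)) =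
    convex_hull (orbit_of G w) ->
  argmax_set (dotp v) (orbit_of G u) x -> orbit_of G w (v + x).
Proof.
move=> sumE [ux xmax].
have [||e e_gt0 epos] := @finite_small_step _ _ dotp
    [set v - g v | g in [set g | G g /\ g v <> v]] v x.
- apply: finite_image; apply: sub_finite_set G_finite; by move=> g [].
- move=> _ [g [Gg gv] <-]; rewrite !dotE subr_gt0.
  by rewrite (dotC _ (g v) v) (dot_moved_lt finG).
set y := v + e *: x in epos.
have peak_v z : orbit_of G v z -> z <> v -> '[z, y] < '[v, y].
  move=> [g Gg <-] gv; rewrite -subr_gt0 -dotNl -dotDl.
  by apply: epos; exists g.
have peak_x z : orbit_of G u z -> z <> x -> '[z, y] < '[x, y].
  move=> uz zx; have [g Gg gxz] : orbit_of G x z by rewrite -(orbit_eq finG ux).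
  have := xmax z uz; rewrite /y !dotE (dotC _ z v) (dotC _ x v) => vz.
  have : '[x, z] < '[x, x] by rewrite -gxz (dot_moved_lt finG) // gxz.
  by rewrite (dotC _ z x) -(ltr_pM2l e_gt0) => xz; lra.
apply: contrapT => nvx.
have hullw z : convex_hull (orbit_of G w) z -> z <> v + x -> '[z, y] < '[v + x, y].
  rewrite -sumE => -[a va [b ub <-]] abvx; rewrite !dotDl.
  case: (pselect (a = v)) => [av|/(convex_hull_peak peak_v va) lta].
    rewrite av ltrD2l; apply: (convex_hull_peak peak_x ub) => bx.
    by apply: abvx; rewrite av bx.
  apply: ltr_leD lta _; case: (pselect (b = x)) => [->//|bx].
  exact/ltW/(convex_hull_peak peak_x ub).
have : convex_hull (orbit_of G w) `<=` [set z | '[z, y] < '[v + x, y]].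
  apply: smallest_sub => [|z wz]; first exact: half_space_convex.
  apply: hullw; first exact: sub_convex_hull.
  by move=> zE; apply: nvx; rewrite -zE.
have vx : convex_hull (orbit_of G w) (v + x).
  rewrite -sumE; exists v; first by apply: sub_convex_hull; apply: (orbit_self finG).
  by exists x => //; apply: sub_convex_hull.
by move/(_ _ vx); rewrite /= ltxx.
Qed.

Lemma SP_peak : property_SP G -> peak_property dotp G.
Proof.
move=> SP v /(regular_free_point finG) fv u; apply/(peak_on_orbit finG).
move=> x1 k Gk x1max x2max; set x2 := k x1 in x2max *.
have [w wE] := SP v u.
have [g1 Gg1 g1w] := argmax_sum_vertex wE x1max.
have [g2 Gg2 g2w] := argmax_sum_vertex wE x2max.
have [h [Gh g1K _ _]] := group_inv finG Gg1.
pose g := (g2 \o h)%VF; have Gg : G g by apply: GM.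
have gE : g v + g x1 = v + x2.
  by rewrite -linearD /= -g1w -g2w comp_lfunE g1K.
have le2 : '[v, g x1] <= '[v, x2].
  by case: x2max => _; apply; apply: (orbit_stable finG) => //; case: x1max.
(* If [g] moved [v], the loss <v, g v> < <v, v> would force <v, g x1> > <v, x2>, against the
   maximality of [x2]. *)
have gv : g v = v.
  apply: contrapT => /(dot_moved_lt finG Gg).
  have := congr1 (dotp v) gE; rewrite !dotDr => vE vgv.
  by move: le2; rewrite -(lerD2l '[v, v]) -vE lerD2r leNgt vgv.
have g1E := fv g Gg gv.
by move: gE; rewrite g1E !id_lfunE => /addrI.
Qed.

(** Moving [g] across the inner product turns it into its inverse, so the inequalities of the
    chamber compare [x] with its whole orbit. *)
Lemma chamber_argmax v x : chamber dotp G v x <->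
  argmax_set (dotp v) (orbit_of G x) x.
Proof.
split=> [vx|[_ xmax] g Gg].
  split=> [|_ [g Gg <-]]; first exact: (orbit_self finG).
  have [h [Gh _ _ hadj]] := group_inv finG Gg.
  rewrite -subr_ge0 (dotC _ v (g x)) hadj (dotC _ v x).
  by rewrite -dotNr -dotDr; apply: vx.
have [h [Gh _ _ hadj]] := group_inv finG Gg.
by rewrite dotDr dotNr subr_ge0 (dotC _ x (g v)) hadj (dotC _ x); apply: xmax; exists h.
Qed.

Lemma chamber_locally_constant_peak :
  chamber_locally_constant dotp G -> peak_property dotp G.
Proof.
move=> cG v rv u; apply/(peak_on_orbit finG) => x g Gg [ux xmax] [_ gxmax].
have [e e0 ve] := cG v rv.
apply: contrapT => gx; have [y yE] : exists y, y = x - g x by exists (x - g x).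
have y0 : y != 0 by rewrite yE subr_eq0; apply/eqP => xg; apply: gx.
have sy0 : 0 < Num.sqrt '[y, y] by rewrite sqrtr_gt0 dot_gt0.
(* The displacement [d *: y] has length e / 2. *)
pose d := e / 2 / Num.sqrt '[y, y].
have d0 : 0 < d by rewrite !divr_gt0.
have vdE : chamber dotp G (v + d *: y) = chamber dotp G v.
  apply: ve; rewrite addrAC subrr add0r !dotE mulrA -expr2 sqrtrM ?sqr_ge0 //.
  rewrite sqrtr_sqr gtr0_norm // /d divfK ?gt_eqF //.
  by rewrite ltr_pdivrMr // ltr_pMr // ltr1n.
have oux := orbit_eq finG ux; rewrite oux in xmax gxmax.
have xx := orbit_self finG x; have xgx := orbit_stable finG Gg xx.
have ogx := orbit_eq finG xgx.
(* Both [x] and [g x] maximize the pairing with [v] and with [v + d *: y], so [y] is orthogonal to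
   both vectors, contradicting d <y, y> > 0. *)
have : chamber dotp G (v + d *: y) x by rewrite vdE; apply/chamber_argmax.
move=> /chamber_argmax[_ /(_ _ xgx) le1].
have : chamber dotp G (v + d *: y) (g x).
  by rewrite vdE; apply/chamber_argmax; rewrite -ogx.
move=> /chamber_argmax[_]; rewrite -ogx => /(_ _ xx) le2.
have := dot_gt0 dotp y0; rewrite -(pmulr_rgt0 _ d0).
have := xmax _ xgx; have := gxmax _ xx; move: le1 le2.
rewrite yE !dotE => le1 le2 le3 le4 pos; clear oux ogx vdE; lra.
Qed.

(* The moved vectors k z - z span the orthogonal complement of the fixed space
   of k; if none of them is a nonzero vector orthogonal to v, they span a line. *)
Lemma nonreflection_normal k v : G k -> k v <> v -> ~ is_reflection dotp k ->
  exists n, [/\ n != 0, '[n, v] = 0 & forall x, k x = x -> '[n, x] = 0].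
Proof.
move=> Gk kv nrefl; have [h [Gh kK hK kadj]] := group_inv finG Gk.
have normal z x : k x = x -> '[k z - z, x] = 0.
  by move=> kx; rewrite dotDl dotNl kadj -{1}kx kK subrr.
apply: contrapT => noN.
have [a aE] : exists a, a = k v - v by exists (k v - v).
have av0 : '[a, v] != 0.
  have := dot_moved_lt finG Gk kv; rewrite aE !dotE (dotC _ (k v)).
  by rewrite -subr_lt0 => /lt_eqF ->.
have moved z : exists c, k z - z = c *: a.
  (* This combination of the moved vectors of [z] and [v] is orthogonal to [v] by the choice of
     coefficients, and is itself a moved vector; hence it vanishes. *)
  pose n := k ('[a, v] *: z - '[k z - z, v] *: v) - ('[a, v] *: z - '[k z - z, v] *: v).
  have nE : n = '[a, v] *: (k z - z) - '[k z - z, v] *: a.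
    rewrite /n aE linearB !linearZ /= !scalerN !scalerBr !opprB.
    rewrite addrACA [RHS]addrACA.
    by congr (_ + _); apply: addrC.
  have n0 : n = 0.
    apply: contrapT => /eqP n0; apply: noN; exists n; split=> //; last exact: normal.
    by rewrite nE !dotE; ring.
  exists ('[k z - z, v] / '[a, v]).
  apply: (scalerI av0); rewrite scalerA mulrC divfK //.
  by apply/eqP; rewrite -subr_eq0 -nE n0.
have a0 : a != 0 by apply: contraNneq av0 => ->; rewrite dot0l.
have aa0 := dot_gt0 dotp a0.
(* [k a] is a multiple of [a] of the same length; if it were [a], then [a] would be fixed, hence
   orthogonal to the moved vector k v - v = a. *)
have ka : k a = - a.
  have [c kaE] := moved a.
  have : k a = (1 + c) *: a by rewrite scalerDl scale1r -kaE addrC subrK.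
  move=> {}kaE; have : '[k a, k a] = '[a, a] := group_isometry finG _ _ Gk.
  rewrite kaE !dotE mulrA -expr2 -[X in _ = X]mul1r => /(mulIf (lt0r_neq0 aa0)).
  move=> /eqP; rewrite sqrf_eq1 => /orP[]/eqP c1; rewrite c1 ?scaleN1r //.
  have := normal v a; rewrite kaE c1 scale1r => /(_ erefl).
  by rewrite -aE => aa; rewrite aa ltxx in aa0.
apply: nrefl; exists a => // z; have [c kzE] := moved z.
rewrite -[LHS](subrK z) kzE addrC; congr (_ + _).
rewrite -scaleNr; congr (_ *: _).
(* Pairing k z = z + c a with [a] now determines [c] as the coefficient of the reflection in [a]. *)
have : '[k z, a] = - '[z, a].
  by rewrite kadj -[in LHS](opprK a) -ka linearN /= kK dotNr.
rewrite -[k z](subrK z) kzE !dotE => E.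
apply: (mulIf (lt0r_neq0 aa0)); rewrite mulNr divfK ?gt_eqF //; lra.
Qed.

(** A reflection fixing [g v] would be conjugate by [g] to an element fixing [v], hence trivial. *)
Lemma free_point_off_mirror v g a : free_point G v -> G g ->
  a != 0 -> G (refl dotp a) -> '[g v, a] != 0.
Proof.
move=> fv Gg a0 Ga; have [h [Gh gK hK _]] := group_inv finG Gg.
apply/eqP => /(refl_id (dotp := dotp)) agv; apply: (refl_neq1 (dotp := dotp) a0).
have hag : (h \o (refl dotp a \o g))%VF = \1%VF.
  by apply: fv; [do 2 apply: GM => // | rewrite !comp_lfunE agv gK].
apply/lfunP => u; rewrite id_lfunE -[in LHS](hK u).
by move/lfunP/(_ (h u)): hag; rewrite !comp_lfunE id_lfunE => /(congr1 g); rewrite !hK.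
Qed.

Lemma peak_coxeter : peak_property dotp G -> coxeter_group dotp G.
Proof.
move=> peakG; split=> //; exists (G `&` is_reflection dotp); first by move=> s [].
have linG : linear_group G by case: finG.
apply/seteqP; split=> [g Gg L [/= [L1 LM _] SL]|]; last by apply: smallest_sub => // s [].
have [v fv] := free_point_exists finG.
(* [L] is any linear group containing the reflections of [G], and [k] runs over the elements of [G]
   in the coset of [g] by [L]. *)
have [||k [Gk [l Ll lkg]] kmax] := @finite_argmax _ _
    [set k | G k /\ exists2 l, L l & (l \o k)%VF = g] (fun k => '[v, k v]).
- by apply: sub_finite_set G_finite => k [].
- by exists g; split=> //; exists \1%VF => //; rewrite comp_lfun1l.
suff k1 : k = \1%VF by rewrite -lkg k1 comp_lfun1r.
apply: contrapT => kn1.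
have kv : k v <> v by move=> /(fv k Gk).
(* No mirror separates [v] from [k v]: since s k is in the same coset, maximality gives the weak
   inequality, and equality would put [v] or [k v] on the mirror of [s]. *)
have root_pos s : G s -> is_reflection dotp s -> 0 < '[v - s v, k v].
  move=> Gs /[dup] srefl /(is_reflectionP dotp)[a a0 sE].
  have : '[v, s (k v)] <= '[v, k v].
    rewrite -comp_lfunE; apply: kmax; split; first exact: GM.
    exists (l \o s)%VF; first by apply: LM => //; apply: SL.
    rewrite -comp_lfunA (comp_lfunA s s) -lkg; congr (_ \o _)%VF.
    by apply/lfunP => u; rewrite !comp_lfunE sE reflK.
  rewrite le_eqVlt => /orP[/eqP|]; last first.
    by rewrite sE -dot_refl // -subr_gt0 -dotNl -dotDl.
  rewrite sE in Gs *; rewrite -dot_refl // => /eqP; rewrite -subr_eq0 -dotNl -dotDl.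
  rewrite [X in '[X - _, _]]reflE addrAC subrr add0r dotNl oppr_eq0 dotZl.
  have va0 := free_point_off_mirror fv G1 a0 Gs; rewrite id_lfunE in va0.
  have kva0 := free_point_off_mirror fv Gk a0 Gs.
  rewrite !mulf_eq0 invr_eq0 (dotC _ a) (negPf va0) (negPf kva0) pnatr_eq0 /=.
  by rewrite (gt_eqF (dot_gt0 dotp a0)).
have /choice[n nP] h : exists n, G h /\ h <> \1%VF /\ ~ is_reflection dotp h ->
    [/\ n != 0, '[n, v] = 0 & forall x, h x = x -> '[n, x] = 0].
  case: (pselect (G h /\ h <> \1%VF /\ ~ is_reflection dotp h)) => [|nh]; last by exists 0.
  move=> [Gh [hn1 hnr]]; have [|m mP] := nonreflection_normal (v := v) Gh _ hnr.
    by move=> /(fv h Gh).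
  by exists m.
have /finite_seqP[sG Gs] := G_finite.
pose good h := `[< h <> \1%VF /\ ~ is_reflection dotp h >].
(* [y] replaces [k v]: it keeps the strict inequalities of [k v] but avoids the normals of all
   nontrivial non-reflections. *)
have [||y ny fy] := @generic_point _ _ dotp [seq n h | h <- sG & good h]
    (k v - v :: [seq v - s v | s : 'End(V) <- sG & `[< is_reflection dotp s >]]) (k v).
- move=> m /mapP[h]; rewrite mem_filter => /andP[/asboolP hgood hs] ->.
  by have [] // := nP h; split=> //; rewrite Gs.
- move=> m; rewrite inE => /orP[/eqP->|/mapP[s]].
    rewrite dotDl dotNl (group_isometry finG) // subr_gt0.
    exact: (dot_moved_lt finG).
  rewrite mem_filter => /andP[/asboolP srefl ss] ->.
  by apply: root_pos => //; rewrite Gs.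
(* Along v + t y, the point [h v] ties with [v] at t equal to minus this ratio, so the maximal ratio
   gives the first tie. *)
have [||h [Gh hy] hmin] := @finite_argmax _ _
    [set h | G h /\ 0 < '[h v - v, y]] (fun h => '[h v - v, v] / '[h v - v, y]).
- by apply: sub_finite_set G_finite => h [].
- by exists k; split=> //; apply: fy; rewrite inE eqxx.
have hn1 : h <> \1%VF by move=> hE; rewrite hE id_lfunE subrr dot0l ltxx in hy.
have hnr : ~ is_reflection dotp h.
  move=> hr; have : 0 < '[v - h v, y].
    apply: fy; rewrite inE; apply/orP; right; apply: map_f.
    by rewrite mem_filter; apply/andP; split; [apply/asboolP | move: Gh; rewrite Gs].
  by rewrite -opprB dotNl oppr_gt0 ltNge ltW.
have moved_lt0 m : G m -> m <> \1%VF -> '[m v - v, v] < 0.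
  move=> Gm mn1; rewrite dotDl dotNl subr_lt0 dotC (dot_moved_lt finG) //.
  by move=> /(fv m Gm).
pose t := - ('[h v - v, v] / '[h v - v, y]).
have t_gt0 : 0 < t by rewrite oppr_gt0 pmulr_llt0 ?invr_gt0 // moved_lt0.
pose x := v + t *: y.
have xle m : G m -> '[m v, x] <= '[v, x].
  move=> Gm; rewrite -subr_le0 -dotNl -dotDl /x dotDr dotZr.
  case: (pselect (m = \1%VF)) => [->|mn1].
    by rewrite id_lfunE subrr !dot0l mulr0 addr0.
  have mv0 := moved_lt0 m Gm mn1.
  case: (ltP 0 '[m v - v, y]) => my.
    have := hmin m (conj Gm my); rewrite ler_pdivrMr // /t; lra.
  have : t * '[m v - v, y] <= 0 by rewrite pmulr_rle0.
  lra.
have hx : '[h v, x] = '[v, x].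
  apply/eqP; rewrite -subr_eq0 -dotNl -dotDl /x dotDr dotZr /t mulNr.
  by rewrite divfK ?subrr // gt_eqF.
have [h' [Gh' hK h'K hadj]] := group_inv finG Gh.
have xmax m : G m -> '[v, m x] <= '[v, x].
  move=> Gm; have [m' [Gm' _ _ madj]] := group_inv finG Gm.
  by rewrite (dotC _ v (m x)) madj dotC xle.
(* At the first tie [x] and [h' x] both maximize <v, .> on the orbit of [x]. *)
have h'x : h' x = x.
  have/(peak_on_orbit finG) pk := peakG v (free_point_regular finG fv) x.
  apply: pk => //; split; first exact: (orbit_self finG).
  - by move=> _ [m Gm <-]; apply: xmax.
  - by apply: (orbit_stable finG) => //; apply: (orbit_self finG).
  - by move=> _ [m Gm <-]; rewrite -hadj hx; apply: xmax.
(* The normal of [h] is orthogonal to [x] and to [v], hence to [y], against genericity. *)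
have [_ nv nfix] := nP h (conj Gh (conj hn1 hnr)).
have : '[n h, x] = 0 by apply: nfix; rewrite -[in LHS]h'x h'K.
rewrite /x dotDr nv add0r dotZr => /eqP; rewrite mulf_eq0 (gt_eqF t_gt0) /=.
apply/negP/ny/map_f; rewrite mem_filter; apply/andP; split; first exact/asboolP.
by move: Gh; rewrite Gs.
Qed.

End PeakProperty.

(** * Comparing distances from a point to mirrors *)

Section ReflectionDescent.
Context {R : realType} {V : vectType R} (dotp : {dot V for idfun}).
Implicit Types (u v a b : V).
Local Notation "''[' u , v ]" := (dotp u v) : ring_scope.
Local Notation refl := (refl dotp).

Lemma dot_sub_refl u v a :
  '[u, v - refl a v] = 2 * '[v, a] / '[a, a] * '[u, a].
Proof. by rewrite reflE opprB addrC subrK dotZr. Qed.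

Lemma dot_refl_gt u v a : 0 < '[v, a] -> '[u, a] < 0 -> '[v, u] < '[v, refl a u].
Proof.
move=> va ua; rewrite -subr_lt0 -dotNr -dotDr dot_sub_refl pmulr_llt0 //.
have a0 : a != 0 by apply: contraTneq va => ->; rewrite dotC dot0l ltxx.
by rewrite pmulr_llt0 ?invr_gt0 ?dot_gt0 // pmulr_rlt0.
Qed.

(** The quantity <v, v - s v> is twice the squared distance from [v] to the mirror of [s]. Strict
    Cauchy-Schwarz, available since the mirrors differ, makes the mirrors of [b] and [refl b a] both
    closer than that of [a]. *)
Lemma refl_descent v a b : a != 0 -> b != 0 -> refl b <> refl a ->
  0 < '[v, a] -> 0 < '[v, b] -> '[a, a] * '[v, b] <= '[a, b] * '[v, a] ->
  '[v, v - refl b v] < '[v, v - refl a v] /\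
  '[v, v - refl (refl b a) v] < '[v, v - refl a v].
Proof.
move=> a0 b0 nab va vb le_ab.
have ba0 : '[refl b a, refl b a] = '[a, a] by rewrite dot_refl // reflK.
rewrite !dot_sub_refl ba0.
have vba : '[v, refl b a] = '[v, a] - 2 * '[a, b] / '[b, b] * '[v, b].
  by rewrite reflE !dotE.
rewrite {}vba {ba0}; have A0 := dot_gt0 dotp a0; have B0 := dot_gt0 dotp b0.
have cs : '[a, b] ^+ 2 < '[a, a] * '[b, b].
  apply: dot_sqr_lt => // k; apply/eqP => akb; apply: nab; rewrite akb reflZ //.
  by apply: contraNneq a0 => k0; rewrite akb k0 scale0r.
move: va vb le_ab A0 B0 cs.
move: '[v, a] '[v, b] '[a, a] '[b, b] '[a, b] => x y A B p x0 y0 le_yx A0 B0 cs.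
have p0 : 0 < p by rewrite -(pmulr_lgt0 _ x0); apply: lt_le_trans le_yx; apply: mulr_gt0.
(* From A p y <= p^2 x < A B x. *)
have pxAB : p * y < x * B.
  rewrite -(ltr_pM2l A0); apply: (@le_lt_trans _ _ (p ^+ 2 * x)).
    have : p * (A * y) <= p * (p * x) by rewrite ler_pM2l.
    by rewrite expr2; lra.
  by rewrite -(ltr_pM2r x0) in cs; lra.
split.
  rewrite -subr_gt0.
  have -> : 2 * x / A * x - 2 * y / B * y = 2 * (x ^+ 2 * B - A * y ^+ 2) / (A * B).
    by field; rewrite !gt_eqF.
  apply: divr_gt0; last exact: mulr_gt0.
  apply: mulr_gt0 => //; rewrite subr_gt0 -(ltr_pM2l A0).
  apply: (@le_lt_trans _ _ ((p * x) ^+ 2)).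
    rewrite mulrA -expr2 -exprMn ler_sqr ?nnegrE //; apply/ltW; exact: mulr_gt0.
  by have := cs; rewrite -(ltr_pM2r (exprn_gt0 2 x0)) exprMn; lra.
(* With this [s], reflecting [a] in [b] changes its pairing with [v] from x to x - 2 s, where 0 < s
   < x. *)
set s := p * y / B.
have s0 : 0 < s by rewrite !mulr_gt0 ?invr_gt0.
have sx : s < x by rewrite ltr_pdivrMr.
have -> : 2 * p / B * y = 2 * s by rewrite /s; ring.
rewrite -subr_gt0.
have -> : 2 * x / A * x - 2 * (x - 2 * s) / A * (x - 2 * s) = 8 * (s * (x - s)) / A.
  by field; rewrite gt_eqF.
by apply: divr_gt0 => //; do 2 apply: mulr_gt0 => //; rewrite subr_gt0.
Qed.

End ReflectionDescent.

(** * Roots of a finite reflection group *)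

Section ReflectionGroup.
Context {R : realType} {V : vectType R} (dotp : {dot V for idfun}).
Variable G : set 'End(V).
Hypothesis finG : finite_orthogonal_group dotp G.
Implicit Types (g h k : 'End(V)) (u v w x y a b c : V) (l p q : seq V).
Local Notation "''[' u , v ]" := (dotp u v) : ring_scope.
Local Notation refl := (refl dotp).

Let G_finite : finite_set G. Proof. by case: finG. Qed.
Let G1 : G \1%VF. Proof. by case: finG => -[]. Qed.
Let GM g h : G g -> G h -> G (g \o h)%VF. Proof. by case: finG => -[_ M _ _ _]; apply: M. Qed.

(** Roots are not normalized: nonzero multiples of a root are roots, so uniqueness is always
    expressed by equality of reflections. *)
Definition root a := a != 0 /\ G (refl a).

Lemma rootN a : root a -> root (- a).
Proof. by case=> a0 Ga; rewrite /root oppr_eq0 reflN. Qed.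

Lemma root_conj g b : G g -> root b -> root (g b).
Proof.
move=> Gg [b0 Gb]; have [h [Gh gK hK _]] := group_inv finG Gg.
have iso_g : isometry dotp dotp g by move=> x y; apply: (group_isometry finG).
split; last by rewrite (refl_conj b iso_g hK); do 2 apply: GM => //.
by apply: contraNneq b0 => gb0; rewrite -(gK b) gb0 linear0.
Qed.

Lemma refl_conj_refl a b : b != 0 -> refl (refl b a) = (refl b \o (refl a \o refl b))%VF.
Proof.
move=> b0; have iso_b x y : '[refl b x, refl b y] = '[x, y] by rewrite dot_refl ?reflK.
by apply: refl_conj => // x; apply: reflK.
Qed.

(** * Words in simple reflections *)

Section Words.
Variable v : V.
Hypothesis fv : free_point G v.

(** The walls of the chamber around [v]: no other mirror separates [v] from its image in the mirror
    of [c]. *)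
Definition simple_root c := [/\ root c, 0 < '[v, c] &
  forall b, root b -> '[v, b] < 0 -> 0 < '[refl c v, b] -> refl b = refl c].

Definition simple_word l := forall c, c \in l -> simple_root c.

Definition word l : 'End(V) := foldr (fun c g => (refl c \o g)%VF) \1%VF l.

Lemma word_cat p q : word (p ++ q) = (word p \o word q)%VF.
Proof. by elim: p => [|c p IHp] /=; rewrite ?comp_lfun1l // IHp comp_lfunA. Qed.

Lemma simple_word_cat p q : simple_word (p ++ q) <-> simple_word p /\ simple_word q.
Proof.
split=> [pq|[sp sq] c]; last by rewrite mem_cat => /orP[/sp|/sq].
by split=> c cpq; apply: pq; rewrite mem_cat cpq ?orbT.
Qed.

Lemma simple_word_cons c l : simple_word (c :: l) <-> simple_root c /\ simple_word l.
Proof.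
split=> [cl|[sc sl] d]; last by rewrite inE => /orP[/eqP->|/sl].
by split=> [|d dl]; apply: cl; rewrite inE ?eqxx // dl orbT.
Qed.

(** The prefixes of [l] carry [v] step by step to [word l v], so some letter [c] crosses the mirror
    of [b]; simplicity identifies that mirror with the image of the mirror of [c] under the
    preceding prefix. Composing [refl b] with [word l] thus deletes [c]. *)
Lemma exchange l b : simple_word l -> root b -> '[v, b] < 0 -> 0 < '[word l v, b] ->
  exists p c q, l = p ++ c :: q /\ (word p \o refl c = refl b \o word p)%VF.
Proof.
elim: l b => [|c l IHl] b; first by rewrite /= id_lfunE => _ _ /ltW; rewrite leNgt => /negP.
move=> /simple_word_cons[[[c0 Gc] vc cP] sl] rb vb; rewrite /= comp_lfunE => lb.
case: (ltP 0 '[refl c v, b]) => cb.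
  by exists [::], c, l; rewrite /= comp_lfun1l comp_lfun1r (cP b).
have {}cb : '[refl c v, b] < 0.
  by rewrite lt_neqAle cb (free_point_off_mirror finG) //; case: rb.
have [|||p [d [q [lE wE]]]] := IHl (refl c b) sl.
- exact: root_conj.
- by rewrite -dot_refl.
- by rewrite -dot_refl.
exists (c :: p), d, q; split; first by rewrite lE.
rewrite /= -comp_lfunA wE refl_conj_refl //.
by apply/lfunP => x; rewrite !comp_lfunE reflK.
Qed.

(* The exchange of the first letter a, read off the root - a, deletes two letters. *)
Lemma positive_word_trivial l : simple_word l ->
  (forall b, root b -> 0 < '[v, b] -> 0 < '[word l v, b]) -> word l = \1%VF.
Proof.
elim: {l}_.+1 {-2}l (ltnSn (size l)) => // n IHn [|a l] // size_l.
move=> /simple_word_cons[[[a0 Ga] va aP] sl] pos.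
have ra : root a by split.
have [|||p [c [q [lE wE]]]] := @exchange l (- a) sl.
- exact: rootN.
- by rewrite dotNr oppr_lt0.
- have := pos a ra va; rewrite /= comp_lfunE dot_refl // refl_root //.
have alE : word (a :: l) = word (p ++ q).
  rewrite lE /= !word_cat /= [(word p \o _)%VF]comp_lfunA wE reflN.
  by apply/lfunP => x; rewrite !comp_lfunE reflK.
rewrite alE in pos *; apply: IHn => //.
  move: size_l; rewrite lE /= !size_cat /= addnS !ltnS => /ltnW; exact: leq_trans.
by move: sl; rewrite lE => /simple_word_cat[sp /simple_word_cons[_ sq]]; apply/simple_word_cat.
Qed.

(** Induction on the distance from [v] to the mirror. If [a] is not simple, some [c] makes the
    mirrors of [c] and [refl c a] closer, and [refl a] is the product of [refl c], [refl (refl c a)]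
    and [refl c]. *)
Lemma refl_word a : root a -> exists2 l, simple_word l & refl a = word l.
Proof.
move=> ra; suff: forall g, [set g | exists2 a, root a & g = refl a] g ->
    exists2 l, simple_word l & g = word l by apply; exists a.
clear a ra; apply: (finite_lt_ind (f := fun g => '[v, v - g v])).
  by apply: sub_finite_set G_finite => _ [b [_ Gb] ->].
move=> _ [b rb ->].
have {b rb} [a [ra va ->]] : exists a, [/\ root a, 0 < '[v, a] & refl b = refl a].
  case: (ltP 0 '[v, b]) => vb; first by exists b.
  exists (- b); split; [exact: rootN | | by rewrite reflN].
  rewrite dotNr oppr_gt0 lt_neqAle vb andbT -[v in '[v, _]]id_lfunE.
  by case: rb => b0 Gb; apply: (free_point_off_mirror finG).
have [a0 Ga] := ra; move=> IH.
case: (pselect (simple_root a)) => [sa|nsa].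
  exists [:: a]; first by apply/simple_word_cons.
  by rewrite /= comp_lfun1r.
have [b [rb vb ab nab]] : exists b,
    [/\ root b, '[v, b] < 0, 0 < '[refl a v, b] & refl b <> refl a].
  apply: contrapT => nb; apply: nsa; split=> // b rb vb ab.
  by apply: contrapT => nab; apply: nb; exists b.
(* -b and refl a b both witness that a is not simple, and the sum of their
   products with v is twice the bound that refl_descent requires. *)
have [c [rc vc le_c nac]] : exists c, [/\ root c, 0 < '[v, c],
    '[a, a] * '[v, c] <= '[a, c] * '[v, a] & refl c <> refl a].
  have A0 := dot_gt0 dotp a0.
  have sumE : '[a, a] * '[v, - b] + '[a, a] * '[v, refl a b] = 2 * ('[a, - b] * '[v, a]).
    rewrite reflE !dotE (dotC _ b a); field; exact: lt0r_neq0.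
  case: (leP ('[a, a] * '[v, - b]) ('[a, - b] * '[v, a])) => le_b.
    exists (- b); split=> //; [exact: rootN | | by rewrite reflN].
    by rewrite dotNr oppr_gt0.
  exists (refl a b); split; first exact: root_conj.
  - by rewrite -dot_refl.
  - have -> : '[a, refl a b] = '[a, - b] by rewrite -dot_refl // refl_root // dotNl dotNr.
    lra.
  move=> rab; apply: nab; apply/lfunP => x.
  have /lfunP/(_ (refl a x)) := rab.
  by rewrite refl_conj_refl // !comp_lfunE !reflK // => /(congr1 (refl a)); rewrite !reflK.
have [c0 Gc] := rc; have [lt1 lt2] := refl_descent a0 c0 nac va vc le_c.
have [|p sp pE] := IH (refl c) _ lt1; first by exists c.
have [|q sq qE] := IH (refl (refl c a)) _ lt2; first by exists (refl c a) => //; exact: root_conj.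
exists (p ++ q ++ p); first by do 2 (apply/simple_word_cat; split => //).
rewrite !word_cat -pE -qE refl_conj_refl //.
by apply/lfunP => x; rewrite !comp_lfunE !reflK.
Qed.

Lemma coxeter_word g : coxeter_group dotp G -> G g ->
  exists2 l, simple_word l & g = word l.
Proof.
move=> [_ [S Srefl GE]]; rewrite GE => /(_ [set g | exists2 l, simple_word l & g = word l]).
apply; split=> [|s Ss /=]; last first.
  have [a a0 sE] := (is_reflectionP dotp s).1 (Srefl s Ss).
  rewrite sE; apply: refl_word; split=> //; rewrite -sE GE.
  exact: sub_gen_smallest.
split=> [|_ _ [p sp ->] [q sq ->]|_ [l sl ->]]; first by exists [::].
  by exists (p ++ q); [apply/simple_word_cat | rewrite word_cat].
(* The inverse of a word is the reversed word. *)
have [l' sl' wE] : exists2 l', simple_word l' &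
    (word l \o word l')%VF = \1%VF /\ (word l' \o word l)%VF = \1%VF.
  elim: l sl => [|c l IHl]; first by exists [::] => //; rewrite !comp_lfun1l.
  move=> /simple_word_cons[sc /IHl[l' sl' [ll' l'l]]]; exists (l' ++ [:: c]).
    by apply/simple_word_cat; split=> //; apply/simple_word_cons.
  have [[c0 _] _ _] := sc; rewrite word_cat /= comp_lfun1r; split; apply/lfunP => x.
    by rewrite !comp_lfunE -(comp_lfunE (word l)) ll' !id_lfunE reflK.
  by rewrite !comp_lfunE reflK // -comp_lfunE l'l.
by exists (word l') => //; exists l'.
Qed.

(** * The closed Weyl chamber of [v] as a fundamental domain *)

Definition dominant u := forall b, root b -> 0 < '[v, b] -> 0 <= '[u, b].

(** Among the [k] with k u = g u, one maximizing <v, k v> sends [v] to the positive side of every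
    positive root, and is therefore trivial. *)
Lemma dominant_orbit_unique u g : coxeter_group dotp G -> G g ->
  dominant u -> dominant (g u) -> g u = u.
Proof.
move=> coxG Gg du dgu.
have [||k [Gk ku] kmax] := @finite_argmax _ _
    [set k | G k /\ k u = g u] (fun k => '[v, k v]).
- by apply: sub_finite_set G_finite => k [].
- by exists g.
rewrite -ku; suff -> : k = \1%VF by rewrite id_lfunE.
have [l sl kE] := coxeter_word coxG Gk; rewrite kE.
apply: positive_word_trivial => // b rb vb; rewrite -kE ltNge; apply/negP.
have [b0 Gb] := rb; rewrite le_eqVlt (negPf (free_point_off_mirror finG fv Gk b0 Gb)) /= => kb.
have [h [Gh _ _ kadj]] := group_inv finG Gk.
(* Dominance of [g u] gives one inequality; dominance of [u] against the root obtained from [- b] by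
   the inverse of [k] gives the other. So [refl b] fixes [g u], and composing it with [k]
   contradicts maximality. *)
have gub : '[g u, b] = 0.
  apply/eqP; rewrite eq_le dgu // andbT -ku kadj -oppr_ge0 -dotNr.
  apply: du; first exact/rootN/root_conj.
  by rewrite dotNr oppr_gt0 -kadj.
have := kmax (refl b \o k)%VF; rewrite /= !comp_lfunE ku refl_id // => /(_ (conj (GM Gb Gk) erefl)).
by rewrite leNgt dot_refl_gt.
Qed.

(** Allowing any [y] on the same side of all mirrors as [v] serves both [v] itself and its
    neighbors. *)
Lemma chamber_dominant y u : (forall b, root b -> 0 < '[v, b] -> 0 < '[y, b]) ->
  chamber dotp G y u -> dominant u.
Proof.
move=> vy yu b [b0 Gb] vb; have := yu _ Gb.
by rewrite dot_sub_refl pmulr_rge0 // divr_gt0 ?dot_gt0 // mulr_gt0 // vy.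
Qed.

(** A maximizer of <y, .> on the orbit of [u] is in the chamber, hence dominant, hence equal to
    [u]. *)
Lemma dominant_chamber y u : coxeter_group dotp G ->
  (forall b, root b -> 0 < '[v, b] -> 0 < '[y, b]) ->
  dominant u -> chamber dotp G y u.
Proof.
move=> coxG vy du; have [z uz zmax] := orbit_argmax finG y u.
have yz : chamber dotp G y z.
  by apply/(chamber_argmax finG); rewrite -(orbit_eq finG uz).
have [g Gg guz] := uz; move: yz (yz); rewrite -{1}guz => /(chamber_dominant vy).
by move/(dominant_orbit_unique coxG Gg du) => <-; rewrite guz.
Qed.

Lemma orbit_dominant u : exists2 x, orbit_of G u x & dominant x.
Proof.
have [x ux xmax] := orbit_argmax finG v u; exists x => //.
apply: (@chamber_dominant v) => //; apply/(chamber_argmax finG).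
by rewrite -(orbit_eq finG ux).
Qed.

End Words.

(** * Coxeter groups satisfy (iii) and SP *)

Lemma coxeter_chamber_locally_constant :
  coxeter_group dotp G -> chamber_locally_constant dotp G.
Proof.
move=> coxG v /(regular_free_point finG) fv.
(* With r = v - s v this yields e |r| < <v, r>, so by Cauchy-Schwarz a shift of [v] shorter than [e]
   keeps the pairing with r positive. *)
have [||e e0 le_e] := @finite_inf_gt0 _ _ [set s | exists2 b, root b & s = refl b]
    (fun s => '[v, v - s v] / (1 + Num.sqrt '[v - s v, v - s v])).
- by apply: sub_finite_set G_finite => _ [b [_ Gb] ->].
- move=> _ [b [b0 Gb] ->]; apply: divr_gt0; last by rewrite ltr_wpDr ?sqrtr_ge0.
  have := free_point_off_mirror finG fv G1 b0 Gb; rewrite id_lfunE => vb.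
  have -> : '[v, v - refl b v] = 2 * '[v, b] ^+ 2 / '[b, b].
    by rewrite dot_sub_refl; ring.
  rewrite divr_gt0 ?dot_gt0 // mulr_gt0 //.
  by rewrite lt_neqAle eq_sym sqrf_eq0 vb sqr_ge0.
exists e => // y; have [d dE] : exists d, d = y - v by exists (y - v).
rewrite -dE => de; have yE : y = v + d by rewrite dE addrC subrK.
have vy b : root b -> 0 < '[v, b] -> 0 < '[y, b].
  move=> rb vb; have [b0 Gb] := rb.
  have := le_e _ (ex_intro2 _ _ b rb erefl).
  have [r rE] : exists r, r = v - refl b v by exists (v - refl b v).
  rewrite -rE ler_pdivlMr; last by rewrite ltr_wpDr ?sqrtr_ge0.
  move=> le_r.
  have cs : `|'[d, r]| <= Num.sqrt '[d, d] * Num.sqrt '[r, r].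
    rewrite -sqrtr_sqr -sqrtrM ?dot_ge0 // ler_wsqrtr // ; exact: dot_sqr_le.
  have de' : Num.sqrt '[d, d] * Num.sqrt '[r, r] <= e * Num.sqrt '[r, r].
    by rewrite ler_wpM2r ?sqrtr_ge0 // ltW.
  have dr : - '[d, r] <= `|'[d, r]| by rewrite ler_normr lexx orbT.
  have : 0 < '[y, r] by rewrite yE dotDl; lra.
  rewrite rE dot_sub_refl pmulr_rgt0 // divr_gt0 ?dot_gt0 // mulr_gt0 //.
apply/seteqP; split=> u.
  by move=> /(chamber_dominant vy); apply: (dominant_chamber fv).
by move=> /(@chamber_dominant v v u (fun _ _ => id)); apply: (dominant_chamber fv).
Qed.

Lemma hull_orbit_stable w x g : G g -> convex_hull (orbit_of G w) x ->
  convex_hull (orbit_of G w) (g x).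
Proof.
move=> Gg; suff: convex_hull (orbit_of G w) `<=`
    [set x | convex_hull (orbit_of G w) (g x)] by apply.
apply: smallest_sub => [|y wy]; last by apply: sub_convex_hull; apply: (orbit_stable finG).
apply/convex_setP => y z t t0 t1 wy wz /=.
rewrite linearD !linearZ /=.
exact: ((convex_setP _).1 (@convex_hull_convex _ _ _) _ _ _ t0 t1 wy wz).
Qed.

(* Write x + z on the segment from p = s x + z to s p, where s is a reflection
   raising x towards the chamber of v; p is in the hull by induction. *)
Lemma dominant_sum_hull v u z x : free_point G v -> coxeter_group dotp G ->
  dominant v u -> dominant v z -> orbit_of G u x ->
  convex_hull (orbit_of G (u + z)) (x + z).
Proof.
move=> fv coxG du dz.
move: x; apply: (@finite_lt_ind _ _ (orbit_of G u) (fun x => - '[v, x])).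
  exact: finite_image.
move=> x [g Gg gux] IH; case: (pselect (dominant v x)) => [dx|ndx].
  rewrite -gux (dominant_orbit_unique fv coxG Gg du) ?gux //.
  by apply: sub_convex_hull; apply: (orbit_self finG).
have [b [rb vb xb]] : exists b, [/\ root b, 0 < '[v, b] & '[x, b] < 0].
  apply: contrapT => nb; apply: ndx => b rb vb; rewrite leNgt; apply/negP => xb.
  by apply: nb; exists b.
have [b0 Gb] := rb; have B0 := dot_gt0 dotp b0.
have [p pE] : exists p : V, p = refl b x + z by exists (refl b x + z).
have hp : convex_hull (orbit_of G (u + z)) p.
  rewrite pE; apply: IH; last by rewrite ltrN2 dot_refl_gt.
  by apply: (orbit_stable finG) => //; exists g.
have hsp := hull_orbit_stable Gb hp.
have zb := dz b rb vb.
have pb : '[p, b] = - '[x, b] + '[z, b] by rewrite pE dotDl dot_refl_root.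
have pb0 : 0 < '[p, b] by rewrite pb; lra.
(* Solves (1 - t) <p, b> = - <x, b>, since x + z differs from [p] by 2 <x, b> / <b, b> times [b];
   the signs of <x, b> and <z, b> place [t] in [0, 1]. *)
pose t := 1 + '[x, b] / '[p, b].
have -> : x + z = t *: p + (1 - t) *: refl b p.
  rewrite (reflE dotp b p) scalerBr addrA -scalerDl [t + _]addrC subrK scale1r.
  have -> : (1 - t) *: ((2 * '[p, b] / '[b, b]) *: b) = - ((2 * '[x, b] / '[b, b]) *: b).
    by rewrite scalerA -scaleNr; congr (_ *: _); rewrite /t; field; rewrite !gt_eqF.
  by rewrite opprK pE reflE addrAC subrK.
have t1 : t <= 1 by rewrite gerDl pmulr_lle0 ?invr_gt0 // ltW.
have t0 : 0 <= t.
  by rewrite -lerBlDl sub0r ler_pdivlMr // pb; lra.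
exact: ((convex_setP _).1 (@convex_hull_convex _ _ _) _ _ _ t0 t1 hp hsp).
Qed.

Lemma coxeter_SP : coxeter_group dotp G -> property_SP G.
Proof.
move=> coxG u0 z0; have [v fv] := free_point_exists finG.
have [u uu du] := orbit_dominant v u0; have [z zz dz] := orbit_dominant v z0.
rewrite (orbit_eq finG uu) (orbit_eq finG zz); exists (u + z).
apply/seteqP; split.
  apply: minkowski_sum_hull_sub; first exact: convex_hull_convex.
  move=> _ _ [g Gg <-] [h Gh <-]; have [k [Gk hK kK _]] := group_inv finG Gh.
  (* Applying the inverse of [h] reduces g u + h z to the case where the second summand is [z]. *)
  rewrite -(kK (g u)) -linearD; apply: hull_orbit_stable => //.
  apply: (dominant_sum_hull fv) => //; do 2 apply: (orbit_stable finG) => //.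
  exact: (orbit_self finG).
apply: smallest_sub => [|_ [g Gg <-]].
  by apply: minkowski_sum_convex; exact: convex_hull_convex.
rewrite linearD; exists (g u); first by apply: sub_convex_hull; exists g.
by exists (g z) => //; apply: sub_convex_hull; exists g.
Qed.

End ReflectionGroup.

(** * Equivalence of SP with (i), (ii) and (iii) *)

Theorem theorem2 (R : realType) (V : vectType R) (dotp : {dot V for idfun})
    (G : set 'End(V)) (finG : finite_orthogonal_group dotp G) :
  [/\ property_SP G <-> peak_property dotp G,
      property_SP G <-> coxeter_group dotp G &
      property_SP G <-> chamber_locally_constant dotp G].
Proof.
have peak_SP peakG := coxeter_SP finG (peak_coxeter finG peakG).
split; split.
- exact: SP_peak.
- exact: peak_SP.
- by move=> /(SP_peak finG); apply: peak_coxeter.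
- exact: coxeter_SP.
- by move=> /(SP_peak finG)/(peak_coxeter finG); apply: coxeter_chamber_locally_constant.
- by move=> /(chamber_locally_constant_peak finG); apply: peak_SP.
Qed.
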